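(* Assume that every finite simple graph $G$ satisfies $q_{list}(G)\le \Delta(G)+1$, where $\Delta(G)$ is the maximum degree of $G$. Let $H=(V,E)$ be a finite linear hypergraph with $n$ vertices. Let $H_3=(V,E_3)$ where $E_3$ is the set of edges of $H$ of rank at least $3$, and let $H_2=(V,E_2)$ where $E_2$ is the set of edges of $H$ of rank exactly $2$. Let $\Delta$ be the maximum degree of $H_3$, and suppose the maximum degree of the graph $H_2$ is at most $n-2\Delta-1$. Then every edge coloring of $H_3$ with colors from a set of $n$ colors can be extended to an edge coloring of $H$ using colors from the same set of $n$ colors.
   Context: A hypergraph $H=(V,E)$ is a finite set $V$ with a set $E$ of subsets of $V$ (edges); the rank of an edge is its cardinality, the degree of a vertex is the number of edges containing it, and $H$ is linear if any two distinct edges share at most one vertex. An edge coloring is a map $\gamma$ from the edges to a set of colors such that $\gamma(e)=\gamma(f)$ for distinct edges $e,f$ only if $e\cap f=\emptyset$. For a graph $G$, $q_{list}(G)$ is the least $k$ such that for every assignment of a list of $k$ colors to each edge of $G$, there is a proper edge coloring of $G$ (adjacent edges receive different colors) in which each edge gets a color from its own list. *)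

(* Defs.v *)
From mathcomp Require Import all_boot.
From mathcomp Require Import boolp.

Set Implicit Arguments.
Unset Strict Implicit.
Unset Printing Implicit Defensive.

(* A hypergraph on the vertex set V is given by its edge set E : {set {set V}}. *)

Section Hypergraph.
Variable V : finType.
Implicit Types E : {set {set V}}.

Definition degree E (v : V) : nat := #|[set e in E | v \in e]|.

Definition max_degree E : nat := \max_(v : V) degree E v.

Definition linear_hypergraph E : Prop :=
  forall e f, e \in E -> f \in E -> e != f -> #|e :&: f| <= 1.

Definition rank_ge3 E : {set {set V}} := [set e in E | 3 <= #|e|].

Definition rank_eq2 E : {set {set V}} := [set e in E | #|e| == 2].

Definition simple_graph E : Prop := forall e, e \in E -> #|e| = 2.

(* Colorings and list assignments have domain [edge E], not [{set V}], so that
   an edgeless hypergraph has a coloring even when there are no colors. *)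
Definition edge E : Type := {e : {set V} | e \in E}.

Definition edge_coloring E (C : Type) (g : edge E -> C) : Prop :=
  forall e f : edge E, e != f -> g e = g f -> [disjoint val e & val f].

Definition extends_coloring E F (C : Type) (g : edge E -> C)
    (g0 : edge F -> C) : Prop :=
  forall (e : edge E) (f : edge F), val e = val f -> g e = g0 f.

Definition edge_choosable E (k : nat) : Prop :=
  forall (C : eqType) (L : edge E -> seq C),
    (forall e, uniq (L e) /\ size (L e) = k) ->
    exists g : edge E -> C, edge_coloring g /\ forall e, g e \in L e.

End Hypergraph.

Lemma distinct_representatives (T C : eqType) (L : T -> seq C) (s : seq T)
    (f0 : T -> C) :
  uniq s -> (forall x, uniq (L x) /\ size s <= size (L x)) ->
  exists f : T -> C, {in s &, injective f} /\ {in s, forall x, f x \in L x}.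
Proof.
elim: s => [|x s IHs] /=; first by exists f0.
case/andP=> xs us HL.
have [|f [finj fL]] := IHs us.
  by move=> y; have [u sz] := HL y; split=> //; apply: ltnW.
have [uL szL] := HL x.
have /hasP[c cL cf] : has (fun c => c \notin map f s) (L x).
  rewrite has_predC; apply/negP => /allP sub.
  by have := uniq_leq_size uL sub; rewrite size_map leqNgt szL.
have neq y : y \in s -> (y == x) = false.
  by move=> ys; apply/negbTE/eqP => yx; rewrite -yx ys in xs.
exists (fun y => if y == x then c else f y); split=> [y z|y]; rewrite !inE.
  case/orP=> [/eqP->|ys] /orP[/eqP->|zs] //; rewrite ?eqxx ?(neq _ ys) ?(neq _ zs).
  - by move=> e; rewrite e map_f in cf.
  - by move=> e; rewrite -e map_f in cf.
  - exact: finj.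
by case/orP=> [/eqP->|ys]; rewrite ?eqxx // (neq _ ys) fL.
Qed.

Lemma edge_choosable_ex (V : finType) (E : {set {set V}}) :
  exists k, `[< edge_choosable E k >].
Proof.
exists #|{: {e : {set V} | e \in E}}|; apply/asboolP => C L HL.
have [f0 _] : exists f0 : edge E -> C, True.
  have F e : 0 < size (L e).
    by have [_ ->] := HL e; apply/card_gt0P; exists e.
  suff h e : {c | c \in L e} by exists (fun e => sval (h e)).
  by case: (L e) (F e) => // c s _; exists c; rewrite mem_head.
have [|f [finj fL]] :=
  @distinct_representatives _ C L (enum {: {e : {set V} | e \in E}}) f0 (enum_uniq _).
  by move=> e; have [u sz] := HL e; rewrite -cardE sz.
exists f; split=> [e g ne eg|e]; last by apply: fL; rewrite mem_enum.
by case/eqP: ne; apply: finj; rewrite ?mem_enum.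
Qed.

(* The list chromatic index. *)
Definition q_list (V : finType) (E : {set {set V}}) : nat :=
  ex_minn (edge_choosable_ex E).

(* Main.v *)
Require Import Defs.
From mathcomp Require Import all_boot.
From mathcomp Require Import boolp.

(** A coloring of F extends to E as soon as every edge e of E :\: F keeps at
    least q_list (E :\: F) colors that F does not use on the edges meeting e: list
    color E :\: F from these. This is applied twice. An edge of rank 2 meets at
    most 2 Delta edges of H_3, so it keeps n - 2 Delta >= Delta(H_2) + 1 colors.
    The edges of rank at most 1 are pairwise disjoint, so one color per list is
    enough for them, and each meets at most Delta(H_2) + Delta < n other edges. *)

Set Implicit Arguments.
Unset Strict Implicit.

Section Degrees.
Variable V : finType.
Implicit Types (E F : {set {set V}}) (e : {set V}).

Definition meeting_edges E e : {set {set V}} := [set f in E | ~~ [disjoint f & e]].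

Lemma degree_leq_max E v : degree E v <= max_degree E.
Proof. exact: (leq_bigmax v). Qed.

Lemma max_degreeU E F : max_degree (E :|: F) <= max_degree E + max_degree F.
Proof.
apply/bigmax_leqP => v _.
apply: leq_trans (leq_add (degree_leq_max E v) (degree_leq_max F v)).
by rewrite /degree !setIdE setIUl leq_card_setU.
Qed.

Lemma meeting_edges_bigcup E e :
  meeting_edges E e = \bigcup_(v in e) [set f in E | v \in f].
Proof.
apply/setP => f; rewrite inE; apply/andP/bigcupP => [[fE]|[v ve]].
  by case/pred0Pn => v /andP[/= vf ve]; exists v; rewrite ?inE ?fE.
by rewrite inE => /andP[-> vf]; split=> //; apply/pred0Pn; exists v; apply/andP.
Qed.

Lemma card_meeting_edges E e : #|meeting_edges E e| <= #|e| * max_degree E.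
Proof.
rewrite meeting_edges_bigcup -sum_nat_const.
elim/big_rec2: _ => [|v m A _ leAm]; first by rewrite cards0.
exact: leq_trans (leq_card_setU _ _) (leq_add (degree_leq_max E v) leAm).
Qed.

End Degrees.

Section Choosability.
Variables (V : finType) (E : {set {set V}}).

Lemma edge_choosable_q_list : edge_choosable E (q_list E).
Proof. by rewrite /q_list; case: ex_minnP => k /asboolP. Qed.

Lemma q_list_leq k : edge_choosable E k -> q_list E <= k.
Proof. by rewrite /q_list; case: ex_minnP => m _ min_m /asboolP /min_m. Qed.

Lemma q_list_coloring (C : eqType) (L : edge E -> seq C) :
  (forall e, uniq (L e) /\ q_list E <= size (L e)) ->
  exists g : edge E -> C, edge_coloring g /\ forall e, g e \in L e.
Proof.
move=> L_large.
have [e|g [g_coloring gL]] :=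
  edge_choosable_q_list (L := fun e => take (q_list E) (L e)).
  by have [uniqL sizeL] := L_large e; rewrite take_uniq // size_takel.
by exists g; split=> // e; apply: mem_take (gL e).
Qed.

Lemma q_list_trivIset : trivIset E -> q_list E <= 1.
Proof.
move=> /trivIsetP disjE; apply: q_list_leq => C L L1.
have /choice[g gL] : forall e, exists c, c \in L e.
  move=> e; have [_] := L1 e.
  by case: (L e) => // c s _; exists c; rewrite mem_head.
by exists g; split=> // e f ne_ef _; apply: disjE (valP e) (valP f) ne_ef.
Qed.

End Choosability.

Section Extension.
Variables (V : finType) (E F : {set {set V}}).

Lemma extends_coloring_trans (D : {set {set V}}) (C : Type)
    (g : edge E -> C) (g' : edge F -> C) (g0 : edge D -> C) :
    D \subset F ->
  extends_coloring g g' -> extends_coloring g' g0 -> extends_coloring g g0.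
Proof.
move=> /subsetP subDF gg' g'g0 e d eq_ed.
have dF : val d \in F by apply: subDF (valP d).
by rewrite (gg' e (Sub (val d) dF)) //; apply: g'g0.
Qed.

Lemma edge_setD_cases (e : edge E) :
  (exists f : edge F, val e = val f) \/
  (exists f : edge (E :\: F), val e = val f).
Proof.
have [eF|eF] := boolP (val e \in F); first by left; exists (Sub (val e) eF).
have eEF : val e \in E :\: F by rewrite inE eF (valP e).
by right; exists (Sub (val e) eEF).
Qed.

Lemma common_extension (C : Type) (g1 : edge F -> C) (g2 : edge (E :\: F) -> C) :
  exists g : edge E -> C, extends_coloring g g1 /\ extends_coloring g g2.
Proof.
have disjoint_edges (f1 : edge F) (f2 : edge (E :\: F)) : val f1 <> val f2.
  by move=> eq_f; have := valP f2; rewrite inE -eq_f (valP f1).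
have /choice[g gP] : forall e : edge E, exists c,
    (forall f, val e = val f -> c = g1 f) /\ (forall f, val e = val f -> c = g2 f).
  move=> e; case: (edge_setD_cases e) => -[f0 ->].
    by exists (g1 f0); split=> f; [move/val_inj-> | move/disjoint_edges].
  by exists (g2 f0); split=> f; [move/esym/disjoint_edges | move/val_inj->].
by exists g; split=> e; have [] := gP e.
Qed.

Lemma edge_coloring_glue (C : Type) (g : edge E -> C)
    (g1 : edge F -> C) (g2 : edge (E :\: F) -> C) :
    edge_coloring g1 -> edge_coloring g2 ->
    (forall f e, g1 f = g2 e -> [disjoint val f & val e]) ->
    extends_coloring g g1 -> extends_coloring g g2 ->
  edge_coloring g.
Proof.
move=> g1_coloring g2_coloring g12_disjoint gg1 gg2.
move=> e f; rewrite -(inj_eq val_inj).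
case: (edge_setD_cases e) (edge_setD_cases f) => [] [e' ee'] [] [f' ff'].
- by rewrite (gg1 _ _ ee') (gg1 _ _ ff') ee' ff'; apply: g1_coloring.
- by rewrite (gg1 _ _ ee') (gg2 _ _ ff') ee' ff' => _; apply: g12_disjoint.
- rewrite (gg2 _ _ ee') (gg1 _ _ ff') ee' ff' disjoint_sym => _ /esym.
  exact: g12_disjoint.
- by rewrite (gg2 _ _ ee') (gg2 _ _ ff') ee' ff'; apply: g2_coloring.
Qed.

Section FreeColors.
Variables (C : finType) (g : edge F -> C).

Definition free_colors (e : {set V}) : {set C} :=
  ~: (g @: [set f : edge F | ~~ [disjoint val f & e]]).

Lemma free_colors_disjoint e f : g f \in free_colors e -> [disjoint val f & e].
Proof.
rewrite in_setC; apply: contraNT => meet.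
by apply: imset_f; rewrite inE.
Qed.

Lemma card_free_colors e :
  #|C| <= #|free_colors e| + #|meeting_edges F e|.
Proof.
rewrite -(cardsC (free_colors e)) leq_add2l setCK.
apply: leq_trans (leq_imset_card _ _) _.
rewrite -(card_imset _ val_inj) subset_leq_card //.
apply/subsetP => _ /imsetP[f /[!inE] meet ->].
by rewrite meet (valP f).
Qed.

Lemma extend_edge_coloring :
    edge_coloring g ->
    {in E :\: F, forall e, q_list (E :\: F) + #|meeting_edges F e| <= #|C|} ->
  exists g' : edge E -> C, edge_coloring g' /\ extends_coloring g' g.
Proof.
move=> g_coloring few_meeting.
have [e|g2 [g2_coloring g2_free]] :=
  q_list_coloring (E := E :\: F) (L := fun e => enum (free_colors (val e))).
  rewrite enum_uniq -cardE -(leq_add2r #|meeting_edges F (val e)|); split=> //.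
  exact: leq_trans (few_meeting _ (valP e)) (card_free_colors _).
have [g' [g'g g'g2]] := common_extension g g2.
exists g'; split=> //; apply: edge_coloring_glue g'g g'g2 => // f e eq_fe.
by apply: free_colors_disjoint; rewrite eq_fe -mem_enum.
Qed.

End FreeColors.
End Extension.

Section Ranks.
Variable V : finType.
Implicit Types E : {set {set V}}.

Definition rank_ge2 E : {set {set V}} := [set e in E | 2 <= #|e|].

Lemma rank_ge3_sub_ge2 E : rank_ge3 E \subset rank_ge2 E.
Proof. by apply/subsetP => e; rewrite !inE => /andP[-> /ltnW]. Qed.

Lemma rank_ge2D_ge3 E : rank_ge2 E :\: rank_ge3 E = rank_eq2 E.
Proof.
by apply/setP => e; rewrite !inE eqn_leq; case: (e \in E); rewrite //= -leqNgt.
Qed.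

Lemma max_degree_rank_ge2 E :
  max_degree (rank_ge2 E) <= max_degree (rank_eq2 E) + max_degree (rank_ge3 E).
Proof.
rewrite -{1}(setID (rank_ge2 E) (rank_ge3 E)) rank_ge2D_ge3.
by rewrite (setIidPr (rank_ge3_sub_ge2 E)) setUC max_degreeU.
Qed.

Lemma trivIset_rank_le1 E : {in E, forall e : {set V}, #|e| <= 1} -> trivIset E.
Proof.
move=> rank_le1; apply/trivIsetP => e f eE fE; apply: contraNT.
case/pred0Pn => v /andP[/= ve vf].
have singleton e' : e' \in E -> v \in e' -> e' = [set v].
  by move=> e'E ve'; apply/esym/eqP; rewrite eqEcard sub1set ve' cards1 rank_le1.
by rewrite (singleton e) // (singleton f).
Qed.

End Ranks.

Theorem theorem8
  (list_edge_coloring : forall (W : finType) (F : {set {set W}}),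
     simple_graph F -> q_list F <= max_degree F + 1)
  (n : nat) (V : finType) (E : {set {set V}})
  (card_V : #|V| = n)
  (E_linear : linear_hypergraph E)
  (max_degree_E2 :
     max_degree (rank_eq2 E) + 2 * max_degree (rank_ge3 E) + 1 <= n)
  (C : finType) (card_C : #|C| = n)
  (g3 : edge (rank_ge3 E) -> C) (g3_coloring : edge_coloring g3) :
  exists g : edge E -> C, edge_coloring g /\ extends_coloring g g3.
Proof.
have E2_simple : simple_graph (rank_eq2 E).
  by move=> e; rewrite inE => /andP[_ /eqP].
have [|g2 [g2_coloring g2_extends]] :=
  extend_edge_coloring (E := rank_ge2 E) g3_coloring.
  rewrite rank_ge2D_ge3 card_C => e /E2_simple rank_e.
  apply: leq_trans max_degree_E2; rewrite addnAC.
  by rewrite leq_add ?list_edge_coloring // -rank_e card_meeting_edges.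
have rank_le1 : {in E :\: rank_ge2 E, forall e : {set V}, #|e| <= 1}.
  by move=> e; rewrite !inE => /andP[+ eE]; rewrite eE -leqNgt.
have max_degree_lt_n : 1 + max_degree (rank_ge2 E) <= n.
  apply: leq_trans max_degree_E2; rewrite addnC leq_add2r.
  by apply: leq_trans (max_degree_rank_ge2 E) _; rewrite leq_add2l leq_pmull.
have [|g [g_coloring g_extends]] := extend_edge_coloring (E := E) g2_coloring.
  move=> e /rank_le1 rank_e; rewrite card_C; apply: leq_trans max_degree_lt_n.
  apply: leq_add; first exact/q_list_trivIset/trivIset_rank_le1.
  apply: leq_trans (card_meeting_edges _ e) _.
  by rewrite -[leqRHS]mul1n leq_mul.
exists g; split=> //.
exact: extends_coloring_trans (rank_ge3_sub_ge2 E) g_extends g2_extends.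
Qed.
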